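(* Define integers $C_{1^15^{-2}}(n)$ for $n\ge 0$ by $$\frac{(q;q)_\infty}{(q^5;q^5)_\infty^2}=\sum_{n\ge0}C_{1^15^{-2}}(n)q^n ,$$ and let $s_{1^15^{-2}}(n):=\operatorname{sgn}(C_{1^15^{-2}}(n))$. Then for all integers $n\ge 0$ $$s_{1^15^{-2}}(n)=\begin{cases}1&\text{if }n\equiv 0\pmod 5,\\ -1&\text{if }n\equiv 1,2\pmod 5,\\ 0&\text{if }n\equiv 3,4\pmod 5.\end{cases}$$
   Context: $(a;q)_\infty:=\prod_{j=0}^{\infty}(1-aq^j)$ is the $q$-Pochhammer symbol; $\operatorname{sgn}(x)\in\{-1,0,1\}$ is the sign of the real number $x$, with $\operatorname{sgn}(0)=0$. *)

(* Defs.v *)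
From HB Require Import structures.
From mathcomp Require Import all_boot all_order all_algebra.
From mathcomp Require Import boolp classical_sets.

Set Implicit Arguments.
Unset Strict Implicit.
Unset Printing Implicit Defensive.

Import Order.TTheory GRing.Theory Num.Theory.
Local Open Scope ring_scope.

(** Formal power series [\sum_n f n * q^n]. *)

Record fps (R : Type) : Type := Fps { fcoef :> nat -> R }.

HB.instance Definition _ (R : Type) := gen_eqMixin (fps R).
HB.instance Definition _ (R : Type) := gen_choiceMixin (fps R).

Lemma fpsP (R : Type) (f g : fps R) : (forall n, f n = g n) -> f = g.
Proof. by case: f g => [f] [g] /= fg; congr Fps; apply: funext. Qed.

Definition fzero (R : nmodType) : fps R := Fps (fun=> 0).
Definition fadd (R : nmodType) (f g : fps R) : fps R := Fps (fun n => f n + g n).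
Definition fopp (R : zmodType) (f : fps R) : fps R := Fps (fun n => - f n).
Definition fone (R : nzRingType) : fps R := Fps (fun n => (n == 0%N)%:R).
Definition fmul (R : nzRingType) (f g : fps R) : fps R :=
  Fps (fun n => \sum_(i < n.+1) f i * g (n - i)%N).

Lemma faddA (R : zmodType) : associative (@fadd R).
Proof. by move=> f g h; apply: fpsP => n /=; rewrite addrA. Qed.
Lemma faddC (R : zmodType) : commutative (@fadd R).
Proof. by move=> f g; apply: fpsP => n /=; rewrite addrC. Qed.
Lemma fadd0 (R : zmodType) : left_id (fzero R) (@fadd R).
Proof. by move=> f; apply: fpsP => n /=; rewrite add0r. Qed.
Lemma faddN (R : zmodType) : left_inverse (fzero R) (@fopp R) (@fadd R).
Proof. by move=> f; apply: fpsP => n /=; rewrite addNr. Qed.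

HB.instance Definition _ (R : zmodType) := GRing.isZmodule.Build (fps R)
  (@faddA R) (@faddC R) (@fadd0 R) (@faddN R).

(* [ftrunc n f] is [f] modulo [q^n.+1]. *)
Definition ftrunc (R : nzRingType) (n : nat) (f : fps R) : {poly R} :=
  \poly_(i < n.+1) f i.

Lemma coef_ftrunc (R : nzRingType) (n : nat) (f : fps R) (i : nat) :
  (i <= n)%N -> (ftrunc n f)`_i = f i.
Proof. by move=> le_in; rewrite coef_poly ltnS le_in. Qed.

Lemma fmul_trunc (R : nzRingType) (n : nat) (f g : fps R) (p r : {poly R})
    (i : nat) :
  (forall j, (j <= n)%N -> p`_j = f j) -> (forall j, (j <= n)%N -> r`_j = g j) ->
  (i <= n)%N -> fmul f g i = (p * r)`_i.
Proof.
move=> pf rg le_in /=; rewrite coefM; apply: eq_bigr => j _.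
have le_ji : (j <= i)%N by rewrite -ltnS.
by rewrite pf ?rg ?(leq_trans _ le_in) ?leq_subr.
Qed.

Lemma fmulA (R : comNzRingType) : associative (@fmul R).
Proof.
move=> f g h; apply: fpsP => n.
have trE (k : fps R) j : (j <= n)%N -> (ftrunc n k)`_j = k j.
  exact: coef_ftrunc.
have mE (k l : fps R) j :
    (j <= n)%N -> (ftrunc n k * ftrunc n l)`_j = fmul k l j.
  by move=> jn; rewrite (fmul_trunc (trE k) (trE l) jn).
rewrite (fmul_trunc (trE f) (mE g h) (leqnn n)).
by rewrite (fmul_trunc (mE f g) (trE h) (leqnn n)) mulrA.
Qed.

Lemma fmulC (R : comNzRingType) : commutative (@fmul R).
Proof.
move=> f g; apply: fpsP => n.
have trE (k : fps R) j : (j <= n)%N -> (ftrunc n k)`_j = k j.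
  exact: coef_ftrunc.
rewrite (fmul_trunc (trE f) (trE g) (leqnn n)) mulrC.
by rewrite (fmul_trunc (trE g) (trE f) (leqnn n)).
Qed.

Lemma fmul1 (R : comNzRingType) : left_id (fone R) (@fmul R).
Proof.
move=> f; apply: fpsP => n /=; rewrite big_ord_recl /= mul1r subn0.
by rewrite big1 ?addr0 // => i _; rewrite mul0r.
Qed.

Lemma fmulDl (R : comNzRingType) : left_distributive (@fmul R) (@fadd R).
Proof.
move=> f g h; apply: fpsP => n /=; rewrite -big_split /=.
by apply: eq_bigr => i _; rewrite mulrDl.
Qed.

Lemma fone_neq0 (R : comNzRingType) : fone R != 0.
Proof.
by apply/eqP => /(congr1 (fun f : fps R => f 0%N)) /= /eqP; rewrite oner_eq0.
Qed.

HB.instance Definition _ (R : comNzRingType) :=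
  GRing.Zmodule_isComNzRing.Build (fps R)
    (@fmulA R) (@fmulC R) (@fmul1 R) (@fmulDl R) (@fone_neq0 R).

(* The coefficients [0, ..., n] of [1 / f], each one solved for from
   [\sum_(i < m.+1) f i * (1 / f) (m - i) = 0] for [m > 0]. *)
Fixpoint finv_seq (R : comUnitRingType) (f : fps R) (n : nat) : seq R :=
  if n is m.+1 then
    let s := finv_seq f m in
    rcons s (- (f 0%N)^-1 * \sum_(i < m.+1) f i.+1 * s`_(m - i))
  else [:: (f 0%N)^-1].

Definition funit (R : comUnitRingType) : {pred fps R} :=
  fun f => f 0%N \is a GRing.unit.

Definition finv (R : comUnitRingType) (f : fps R) : fps R :=
  if funit f then Fps (fun n => (finv_seq f n)`_n) else f.

Lemma size_finv_seq (R : comUnitRingType) (f : fps R) (n : nat) :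
  size (finv_seq f n) = n.+1.
Proof. by elim: n => //= n IH; rewrite size_rcons IH. Qed.

Lemma nth_finv_seq (R : comUnitRingType) (f : fps R) (n i : nat) :
  (i <= n)%N -> (finv_seq f n)`_i = (finv_seq f i)`_i.
Proof.
elim: n => [|n IH]; first by rewrite leqn0 => /eqP ->.
rewrite leq_eqVlt => /predU1P[-> //|]; rewrite ltnS => le_in.
by rewrite /= nth_rcons size_finv_seq ltnS le_in IH.
Qed.

Lemma fmulV (R : comUnitRingType) :
  {in @funit R, left_inverse 1 (@finv R) *%R}.
Proof.
move=> f uf; rewrite mulrC; apply: fpsP => -[|n]; rewrite /finv.
  by rewrite /= [funit f]uf big_ord_recl big_ord0 addr0 /= divrr.
rewrite [funit f]uf [LHS]/= big_ord_recl subn0 [nth _ _ _]/= nth_rcons.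
rewrite size_finv_seq ltnn eqxx mulrA mulrN divrr // mulN1r.
rewrite [RHS]/= addrC; apply/eqP; rewrite subr_eq0; apply/eqP.
apply: eq_bigr => i _; rewrite lift0 subSS [RHS](congr1 _ (@nth_finv_seq _ f n _ _)) //.
exact: leq_subr.
Qed.

Lemma funitPl (R : comUnitRingType) (f g : fps R) : g * f = 1 -> funit f.
Proof.
move=> /(congr1 (fun h : fps R => h 0%N)) /=.
rewrite big_ord_recl big_ord0 addr0 /= => gf.
by apply/unitrP; exists (g 0%N); rewrite gf mulrC gf.
Qed.

Lemma finv_out (R : comUnitRingType) : {in [predC @funit R], @finv R =1 id}.
Proof. by move=> f /negP nuf; rewrite /finv; case: ifP => // /nuf. Qed.

HB.instance Definition _ (R : comUnitRingType) :=
  GRing.ComNzRing_hasMulInverse.Build (fps R)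
    (@fmulV R) (@funitPl R) (@finv_out R).

Arguments fcoef : simpl never.

Lemma fcoef0 (R : zmodType) (n : nat) : (0 : fps R) n = 0.
Proof. by []. Qed.
Lemma fcoefD (R : zmodType) (f g : fps R) (n : nat) : (f + g) n = f n + g n.
Proof. by []. Qed.
Lemma fcoefN (R : zmodType) (f : fps R) (n : nat) : (- f) n = - f n.
Proof. by []. Qed.
Lemma fcoefB (R : zmodType) (f g : fps R) (n : nat) : (f - g) n = f n - g n.
Proof. by []. Qed.
Lemma fcoef1 (R : comNzRingType) (n : nat) : (1 : fps R) n = (n == 0%N)%:R.
Proof. by []. Qed.
Lemma fcoefM (R : comNzRingType) (f g : fps R) (n : nat) :
  (f * g) n = \sum_(i < n.+1) f i * g (n - i)%N.
Proof. by []. Qed.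

Definition qvar (R : nzRingType) : fps R := Fps (fun n => (n == 1%N)%:R).

(** Coefficientwise (i.e. [q]-adic) convergence. *)
Definition fps_cvg (R : Type) (u : nat -> fps R) (l : fps R) : Prop :=
  forall n, exists N, forall m, (N <= m)%N -> u m n = l n.

Definition fps_lim (R : zmodType) (u : nat -> fps R) : fps R :=
  xget 0 [set l | fps_cvg u l].

Lemma fps_cvg_unique (R : Type) (u : nat -> fps R) (l l' : fps R) :
  fps_cvg u l -> fps_cvg u l' -> l = l'.
Proof.
move=> ul ul'; apply: fpsP => n; have [N uN] := ul n; have [N' uN'] := ul' n.
by rewrite -(uN (maxn N N')) ?leq_maxl // uN' // leq_maxr.
Qed.

Lemma fps_lim_cvg (R : zmodType) (u : nat -> fps R) (l : fps R) :
  fps_cvg u l -> fps_lim u = l.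
Proof.
rewrite /fps_lim => ul; case: xgetP => [l' _ ul'|/(_ l)//].
exact: fps_cvg_unique ul' ul.
Qed.

(** [(a; x)_oo], where [a] and [x] are themselves power series in [q]. *)
Definition qpoch_inf (R : comNzRingType) (a x : fps R) : fps R :=
  fps_lim (fun m => \prod_(j < m) (1 - a * x ^+ j)).

Lemma qvarXE (R : comNzRingType) (k n : nat) : (qvar R ^+ k) n = (n == k)%:R.
Proof.
elim: k n => [|k IH] n; first by rewrite expr0 fcoef1.
rewrite exprS fcoefM big_ord_recl mul0r add0r; case: n => [|n].
  by rewrite big_ord0.
rewrite big_ord_recl mul1r IH lift0 subSS subn0 big1 ?addr0 // => i _.
by rewrite mul0r.
Qed.

(* The infinite products used below converge, so that [fps_lim] does not
   take its default value. *)
Lemma qpoch_inf_cvg (R : comNzRingType) (k : nat) : (0 < k)%N ->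
  fps_cvg (fun m => \prod_(j < m) (1 - qvar R ^+ k * (qvar R ^+ k) ^+ j))
          (qpoch_inf (qvar R ^+ k) (qvar R ^+ k)).
Proof.
move=> k_gt0; set u := fun m => _.
have uS m n : (n <= m)%N -> u m.+1 n = u m n.
  move=> le_nm; rewrite /u big_ord_recr /= mulrBr mulr1 -exprS -exprM.
  rewrite fcoefB fcoefM [X in _ - X]big1 ?subr0 // => i _.
  rewrite qvarXE (_ : (n - i == k * m.+1)%N = false) ?mulr0 //.
  apply/ltn_eqF; apply: leq_ltn_trans (leq_subr _ _) _.
  exact: leq_ltn_trans le_nm (leq_pmull m.+1 k_gt0).
have ucvg : fps_cvg u (Fps (fun n => u n n)).
  move=> n; exists n; elim=> [|m IH]; first by rewrite leqn0 => /eqP ->.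
  rewrite leq_eqVlt => /predU1P[-> //|]; rewrite ltnS => le_nm.
  by rewrite uS // IH.
by rewrite /qpoch_inf -/u (fps_lim_cvg ucvg).
Qed.

Lemma qpoch_inf_unit (R : comUnitRingType) (k : nat) : (0 < k)%N ->
  qpoch_inf (qvar R ^+ k) (qvar R ^+ k) \is a GRing.unit.
Proof.
move=> k_gt0; have [N /(_ N (leqnn N))] := qpoch_inf_cvg R k_gt0 0.
suff -> : (\prod_(j < N) (1 - qvar R ^+ k * (qvar R ^+ k) ^+ j)) 0%N = 1.
  by move=> e; rewrite /in_mem /= /funit -e unitr1.
elim: N => [|N IH]; first by rewrite big_ord0.
rewrite big_ord_recr /= fcoefM big_ord_recl big_ord0 addr0 IH mul1r.
rewrite -exprS -exprM fcoefB fcoef1 eqxx qvarXE ltn_eqF ?subr0 //.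
by rewrite muln_gt0 k_gt0.
Qed.

(** [(q; q)_oo / (q^5; q^5)_oo ^ 2 = \sum_n C_1p1_5m2 n * q^n] *)
Definition C_1p1_5m2 : nat -> int :=
  let q := qvar int in
  fcoef (qpoch_inf q q / qpoch_inf (q ^+ 5) (q ^+ 5) ^+ 2).

Definition s_1p1_5m2 (n : nat) : int := Num.sg (C_1p1_5m2 n).

(* Main.v *)
Require Import Defs.
From mathcomp Require Import all_boot all_order all_algebra.
From mathcomp Require Import zify ring.
From mathcomp Require boolp.

(**
Write (a; x) for the infinite product of the factors 1 - a x^j, and P_i for
(q^(5i); q^25), 1 <= i <= 5.  The theorem follows from the 5-dissection of
Euler's product in which every component is itself an infinite product:

  (q; q) = P_2 P_3 P_5 / (P_1 P_4) - q P_5 - q^2 P_1 P_4 P_5 / (P_2 P_3).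

As (q^5; q^5) = P_1 P_2 P_3 P_4 P_5, dividing by its square turns the three
components into 1 / M_0, - q / M_1 and - q^2 / M_2, where each M_r is a
monomial in the P_i with positive exponents (euler_dissection_products).  All
the series 1 / P_i have nonnegative coefficients and involve only powers of
q^5; moreover P_1 divides every M_r and contributes the factor 1 / (1 - q^5),
whose coefficients at all multiples of 5 are positive.  Hence 1 / M_r has
positive coefficients exactly at the multiples of 5, and the three components
live in the residue classes 0, 1, 2 modulo 5, with signs +, -, -.

For the dissection, the pentagonal number theorem gives (q; q) as a bilateral
sum, which is cut according to the residue modulo 5 of the summation index
(euler_5dissection).  The classes 0 and 2 combine into one instance of the sum
side of the quintuple product identity, the classes 3 and 4 into another, and
the class 1 is again a pentagonal series.  The quintuple sums are turned into
products by the identity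

  sum of E * sum of theta(z^2) = sum of theta(z) * quintuple sum,

where theta(z) is the series of Jacobi's triple product and E that of Euler's
product (quintuple_product): both sides are double sums over pairs of
integers, attached to the same binary quadratic form 3 X^2 + Y^2, and they are
matched by isometries of that form with half-integral entries.  The triple product itself
(jacobi_triple_product) is the limit of a finite identity, a specialization of
the q-binomial theorem.

Infinite sums are handled by a q-adic notion of unconditional summability
(is_sum), which allows arbitrary reindexing, products and regroupings.
*)

Set Implicit Arguments.
Unset Strict Implicit.
Unset Printing Implicit Defensive.

Import Order.TTheory GRing.Theory Num.Theory.
Local Open Scope ring_scope.

(** * Congruence of power series modulo a power of q *)

Section Congruence.

Variable R : comUnitRingType.
Implicit Types (f g h : fps R) (N : nat).

Definition eqmodq N f g := forall n, (n < N)%N -> f n = g n.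

Lemma eqmodq_refl N f : eqmodq N f f.
Proof. by []. Qed.

Lemma eqmodq_sym N f g : eqmodq N f g -> eqmodq N g f.
Proof. by move=> fg n /fg. Qed.

Lemma eqmodq_trans N g f h : eqmodq N f g -> eqmodq N g h -> eqmodq N f h.
Proof. by move=> fg gh n nN; rewrite fg // gh. Qed.

Lemma eqmodqP f g : (forall N, eqmodq N f g) -> f = g.
Proof. by move=> fg; apply: fpsP => n; apply: (fg n.+1). Qed.

Lemma eqmodqD N f g f' g' :
  eqmodq N f g -> eqmodq N f' g' -> eqmodq N (f + f') (g + g').
Proof. by move=> fg fg' n nN; rewrite !fcoefD fg // fg'. Qed.

Lemma eqmodqM N f g f' g' :
  eqmodq N f g -> eqmodq N f' g' -> eqmodq N (f * f') (g * g').
Proof.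
move=> fg fg' n nN; rewrite !fcoefM; apply: eq_bigr => i _.
by rewrite fg ?fg' //; apply: leq_ltn_trans nN; rewrite ?leq_subr // -ltnS.
Qed.

Lemma eqmodq_sum N (I : Type) (r : seq I) (F G : I -> fps R) :
  (forall i, eqmodq N (F i) (G i)) ->
  eqmodq N (\sum_(i <- r) F i) (\sum_(i <- r) G i).
Proof.
move=> FG; elim: r => [|i r IH]; first by rewrite !big_nil.
by rewrite !big_cons; apply: eqmodqD.
Qed.

Lemma eqmodq_prod N (I : Type) (r : seq I) (F G : I -> fps R) :
  (forall i, eqmodq N (F i) (G i)) ->
  eqmodq N (\prod_(i <- r) F i) (\prod_(i <- r) G i).
Proof.
move=> FG; elim: r => [|i r IH]; first by rewrite !big_nil.
by rewrite !big_cons; apply: eqmodqM.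
Qed.

Lemma unit_fps f : f 0%N = 1 -> f \is a GRing.unit.
Proof. by move=> f0; rewrite unfold_in /= /funit f0 unitr1. Qed.

Lemma eqmodqV N f g : f \is a GRing.unit -> g \is a GRing.unit ->
  eqmodq N f g -> eqmodq N f^-1 g^-1.
Proof.
move=> uf ug fg.
suff : eqmodq N (f^-1 * g * g^-1) (f^-1 * f * g^-1).
  by rewrite mulrK // mulVr // mul1r.
by apply: eqmodqM => //; apply: eqmodqM => //; apply: eqmodq_sym.
Qed.

Lemma fcoef0M f g : (f * g) 0%N = f 0%N * g 0%N.
Proof. by rewrite fcoefM big_ord_recl big_ord0 addr0. Qed.

Lemma eqmodq_qvarX N m : (N <= m)%N -> eqmodq N (qvar R ^+ m) 0.
Proof.
by move=> Nm n nN; rewrite qvarXE fcoef0 ltn_eqF // (leq_trans nN).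
Qed.

Lemma coef_qvarXM m f n :
  (qvar R ^+ m * f) n = if (m <= n)%N then f (n - m)%N else 0.
Proof.
rewrite fcoefM; case: leqP => [mn|nm].
  rewrite (bigD1 (Ordinal (mn : (m < n.+1)%N))) //= qvarXE eqxx mul1r.
  rewrite big1 ?addr0 // => i /negbTE im; rewrite qvarXE.
  by rewrite (_ : (_ == _) = false) ?mul0r.
rewrite big1 // => i _; rewrite qvarXE ltn_eqF ?mul0r //.
by apply: leq_ltn_trans nm; rewrite -ltnS.
Qed.

Lemma qvarX_lreg m : GRing.lreg (qvar R ^+ m).
Proof.
move=> f g fg; apply: fpsP => n.
have := congr1 (fun h : fps R => h (m + n)%N) fg.
by rewrite !coef_qvarXM leq_addr addKn.
Qed.

End Congruence.

(** * Unconditional q-adic sums *)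

Section Sums.

Variable R : comUnitRingType.
Implicit Types (l : fps R) (N : nat).

Definition tail0 N (I : eqType) (F : I -> fps R) (X : seq I) :=
  forall i, i \notin X -> eqmodq N (F i) 0.

(** The usual definition by nets would ask that the partial sums over all large
    enough finite sets agree with [l] modulo [q^N]; over a complete
    non-archimedean ring this amounts to the terms tending to [0], which is the
    form that makes products of sums immediate. *)
Definition is_sum (I : eqType) (F : I -> fps R) l :=
  forall N, exists X : seq I,
    [/\ uniq X, tail0 N F X & eqmodq N (\sum_(i <- X) F i) l].

Lemma tail0_sum N (I : eqType) (F : I -> fps R) (X Y : seq I) :
  uniq X -> uniq Y -> tail0 N F X -> {subset X <= Y} ->
  eqmodq N (\sum_(i <- Y) F i) (\sum_(i <- X) F i).
Proof.
move=> uX uY FX XY; rewrite (bigID (mem X) (r := Y)) /=.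
rewrite -[X in eqmodq _ _ X]addr0; apply: eqmodqD.
  rewrite -big_filter (perm_big X) //; apply: uniq_perm => // [|i].
    exact: filter_uniq.
  by rewrite mem_filter; apply/andb_idr/XY.
elim/big_ind: _ => // f g f0 g0; rewrite -[X in eqmodq _ _ X]addr0.
exact: eqmodqD.
Qed.

(** The set [X] of the definition of [is_sum] may be exchanged for any other one
    satisfying its first two conditions: both sums agree with the sum over the
    union.  Uniqueness of sums follows, and with it all identities below that
    equate two evaluations of the same family. *)
Lemma is_sum_eq N (I : eqType) (F : I -> fps R) l (X : seq I) :
  is_sum F l -> uniq X -> tail0 N F X -> eqmodq N (\sum_(i <- X) F i) l.
Proof.
move=> /(_ N) [Y [uY FY lY]] uX FX; apply: eqmodq_trans lY.
have XZ : {subset X <= undup (X ++ Y)} by move=> i; rewrite mem_undup mem_cat => ->.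
have YZ : {subset Y <= undup (X ++ Y)}.
  by move=> i; rewrite mem_undup mem_cat orbC => ->.
have uZ := undup_uniq (X ++ Y).
apply: eqmodq_trans (tail0_sum uY uZ FY YZ).
exact: eqmodq_sym (tail0_sum uX uZ FX XZ).
Qed.

Lemma is_sum_unique (I : eqType) (F : I -> fps R) l l' :
  is_sum F l -> is_sum F l' -> l = l'.
Proof.
move=> Fl Fl'; apply: eqmodqP => N; have [X [uX FX lX]] := Fl' N.
by apply: eqmodq_trans lX; apply/eqmodq_sym/is_sum_eq.
Qed.

Definition summable (I : eqType) (F : I -> fps R) :=
  forall N, exists X : seq I, uniq X /\ tail0 N F X.

Lemma is_sum_summable (I : eqType) (F : I -> fps R) l : is_sum F l -> summable F.
Proof. by move=> Fl N; have [X [uX FX _]] := Fl N; exists X. Qed.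

(** The coefficient of [q^n] of the sum is read off the finite set that works
    modulo [q^(n+1)]; choice makes these sets a function of [n]. *)
Lemma summable_is_sum (I : choiceType) (F : I -> fps R) :
  summable F -> exists l, is_sum F l.
Proof.
move=> /boolp.choice [X XP].
exists (Fps (fun n => (\sum_(i <- X n.+1) F i) n)) => N; exists (X N).
have [uN FN] := XP N; split=> // n nN.
have [un Fn] := XP n.+1.
have XZ : {subset X N <= undup (X N ++ X n.+1)}.
  by move=> i; rewrite mem_undup mem_cat => ->.
have YZ : {subset X n.+1 <= undup (X N ++ X n.+1)}.
  by move=> i; rewrite mem_undup mem_cat orbC => ->.
have uZ := undup_uniq (X N ++ X n.+1).
rewrite -(tail0_sum uN uZ FN XZ) //.
exact: (tail0_sum un uZ Fn YZ).
Qed.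

Lemma summable_inj (I J : eqType) (F : I -> fps R) (p : J -> I) (r : I -> J) :
  cancel p r -> summable F -> summable (F \o p).
Proof.
move=> pK Fs N; have [X [uX FX]] := Fs N.
exists (undup (map r X)); split; first exact: undup_uniq.
move=> j; rewrite mem_undup => jX; apply: FX; apply: contra jX => pjX.
by apply/mapP; exists (p j); rewrite ?pK.
Qed.

Lemma is_sum_reindex (I J : eqType) (F : I -> fps R) l (p : J -> I) (r : I -> J) :
  cancel p r -> cancel r p -> is_sum F l -> is_sum (F \o p) l.
Proof.
move=> pK rK Fl N; have [X [uX FX lX]] := Fl N; exists (map r X); split.
- by rewrite map_inj_uniq //; apply: can_inj rK.
- by move=> j jX; apply: FX; apply: contra jX => pjX; rewrite -[j]pK map_f.
- by rewrite big_map (eq_bigr F) // => i _ /=; rewrite rK.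
Qed.

Lemma eq_is_sum (I : eqType) (F G : I -> fps R) l :
  F =1 G -> is_sum F l -> is_sum G l.
Proof.
move=> FG Fl N; have [X [uX FX lX]] := Fl N; exists X; split=> //.
  by move=> i /FX; rewrite FG.
by rewrite (eq_bigr F) // => i _; rewrite FG.
Qed.

Lemma is_sumZ (I : eqType) (F : I -> fps R) l c :
  is_sum F l -> is_sum (fun i => c * F i) (c * l).
Proof.
move=> Fl N; have [X [uX FX lX]] := Fl N; exists X; split=> //.
  by move=> i /FX Fi0; rewrite -[0](mulr0 c); apply: eqmodqM.
by rewrite -mulr_sumr; apply: eqmodqM.
Qed.

(** A product of two terms vanishes modulo [q^N] as soon as one of them does, so
    a rectangle is a valid finite set for the double family. *)
Lemma is_sumM (I J : eqType) (F : I -> fps R) (G : J -> fps R) l l' :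
  is_sum F l -> is_sum G l' ->
  is_sum (fun ij : I * J => F ij.1 * G ij.2) (l * l').
Proof.
move=> Fl Gl N; have [X [uX FX lX]] := Fl N; have [Y [uY GY lY]] := Gl N.
exists [seq (i, j) | i <- X, j <- Y]; split.
- by apply: allpairs_uniq => // -[i j] [i' j'].
- move=> [i j] ijXY /=.
  have [iX|/FX Fi0] := boolP (i \in X); last first.
    by rewrite -[0](mul0r (G j)); apply: eqmodqM.
  have [jY|/GY Gj0] := boolP (j \in Y); last first.
    by rewrite -[0](mulr0 (F i)); apply: eqmodqM.
  by case/negP: ijXY; apply/allpairsP; exists (i, j).
- rewrite big_allpairs /=.
  under eq_bigr => i _ do rewrite -mulr_sumr.
  by rewrite -mulr_suml; apply: eqmodqM.
Qed.

Lemma is_sum_pieces (K : finType) (J : eqType) (F : K * J -> fps R) (l : K -> fps R) :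
  (forall k, is_sum (fun j => F (k, j)) (l k)) -> is_sum F (\sum_k l k).
Proof.
move=> Fl N; have /fin_all_exists[X XP] := fun k => Fl k N.
exists [seq (k, j) | k <- enum K, j <- X k]; split.
- apply: allpairs_uniq_dep => [|k _|]; first exact: enum_uniq.
    by have [] := XP k.
  by move=> [k j] [k' j'] _ _ /= [-> ->].
- move=> [k j] kjX; have [_ FX _] := XP k; apply: FX; apply: contra kjX => jX.
  by apply/allpairsPdep; exists k, j; rewrite mem_enum.
- rewrite big_allpairs_dep big_enum /=; apply: eqmodq_sum => k.
  by have [_ _] := XP k.
Qed.

(** The form in which double sums are cut into parity classes and bilateral sums
    into residue classes: [K] indexes the classes. *)
Lemma is_sum_split (K : finType) (I J : choiceType) (F : I -> fps R) l
    (p : K * J -> I) (r : I -> K * J) :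
  cancel p r -> cancel r p -> is_sum F l ->
  exists2 lk : K -> fps R, l = \sum_k lk k
    & forall k, is_sum (fun j => F (p (k, j))) (lk k).
Proof.
move=> pK rK Fl; have Fpl := is_sum_reindex pK rK Fl.
have /fin_all_exists[lk lkP] k : exists lk, is_sum (fun j => F (p (k, j))) lk.
  apply: summable_is_sum.
  have kK : cancel (fun j => (k, j) : K * J) snd by [].
  exact: (summable_inj kK (is_sum_summable Fpl)).
by exists lk => //; apply: (is_sum_unique Fpl); apply: is_sum_pieces.
Qed.

End Sums.

(** * Infinite products *)

Section Pochhammer.

Variable R : comUnitRingType.
Local Notation q := (qvar R).

Definition pochn (a k m : nat) : fps R := \prod_(j < m) (1 - q ^+ (a + k * j)).

Definition poch (a k : nat) : fps R := qpoch_inf (q ^+ a) (q ^+ k).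

Lemma pochnS a k m : pochn a k m.+1 = pochn a k m * (1 - q ^+ (a + k * m)).
Proof. exact: big_ord_recr. Qed.

(** All factors of rank at least [m] are congruent to [1]. *)
Lemma pochn_stable a k m p N : (N <= a + k * m)%N -> (m <= p)%N ->
  eqmodq N (pochn a k p) (pochn a k m).
Proof.
move=> Nm /subnK <-; elim: (p - m)%N => [|r IH]; first by rewrite add0n.
rewrite addSn pochnS -[pochn a k m]mulr1; apply: eqmodqM => // n nN.
rewrite fcoefB (@eqmodq_qvarX R N) // ?fcoef0 ?subr0 //.
by apply: leq_trans Nm _; rewrite leq_add2l leq_mul2l leq_addl orbT.
Qed.

Lemma poch_pochn a k m N : (0 < k)%N -> (N <= a + k * m)%N ->
  eqmodq N (poch a k) (pochn a k m).
Proof.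
move=> k_gt0.
suff cvg : fps_cvg (pochn a k) (poch a k).
  move=> le_Nm n nN; have [M] := cvg n.
  move/(_ (maxn M m) (leq_maxl _ _)) <-.
  exact: (pochn_stable le_Nm (leq_maxr M m)).
have lim : fps_cvg (pochn a k) (Fps (fun n => pochn a k n.+1 n)).
  move=> n; exists n.+1 => p nm /=.
  rewrite [RHS]/fcoef /=; apply: (@pochn_stable a k n.+1 p n.+1) => //.
  by rewrite (leq_trans (leq_pmull n.+1 k_gt0)) ?leq_addl.
suff -> : poch a k = Fps (fun n => pochn a k n.+1 n) by [].
apply: fps_lim_cvg; rewrite (_ : (fun m => _) = pochn a k) //.
apply: boolp.funext => p; apply: eq_bigr => j _.
by rewrite exprD exprM.
Qed.

Lemma pochn_coef0 a k m : (0 < a)%N -> pochn a k m 0%N = 1.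
Proof.
move=> a_gt0; elim: m => [|m IH]; first by rewrite /pochn big_ord0.
rewrite pochnS fcoef0M IH mul1r fcoefB fcoef1 qvarXE /=.
by rewrite ltn_eqF ?subr0 // addn_gt0 a_gt0.
Qed.

Lemma poch_coef0 a k : (0 < a)%N -> (0 < k)%N -> poch a k 0%N = 1.
Proof.
move=> a_gt0 k_gt0; rewrite (@poch_pochn a k 1 1) ?pochn_coef0 //.
by rewrite addn_gt0 a_gt0.
Qed.

Lemma poch_unit a k : (0 < a)%N -> (0 < k)%N -> poch a k \is a GRing.unit.
Proof. by move=> a_gt0 k_gt0; apply/unit_fps/poch_coef0. Qed.

Lemma poch_shift a k : (0 < k)%N -> poch a k = (1 - q ^+ a) * poch (a + k) k.
Proof.
move=> k_gt0; apply: eqmodqP => N.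
have le m : (N <= m + k * N)%N.
  by rewrite (leq_trans (leq_pmull N k_gt0)) ?leq_addl.
apply: eqmodq_trans (_ : eqmodq N _ (pochn a k N.+1)) _.
  by apply: poch_pochn => //; rewrite mulnS addnA le.
rewrite {1}/pochn big_ord_recl muln0 addn0; apply: eqmodqM => //.
apply: eqmodq_sym; rewrite (_ : \prod_(i < N) _ = pochn (a + k) k N).
  exact: poch_pochn.
by apply: eq_bigr => i _; rewrite lift0 mulnS addnA.
Qed.

(** The factors are sorted by the residue of their rank modulo [c]. *)
Lemma poch_multisection a k c : (0 < k)%N -> (0 < c)%N ->
  poch a k = \prod_(r < c) poch (a + k * r) (k * c).
Proof.
move=> k_gt0 c_gt0; apply: eqmodqP => N.
apply: eqmodq_trans (_ : eqmodq N _ (pochn a k (c * N))) _.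
  apply: poch_pochn => //; apply: leq_trans (leq_addl _ _).
  by rewrite mulnA leq_pmull // muln_gt0 k_gt0.
have -> : pochn a k (c * N) = \prod_(r < c) pochn (a + k * r) (k * c) N.
  elim: N => [|N IH].
    by rewrite muln0 big1 => [|i _]; rewrite /pochn big_ord0.
  rewrite mulnS addnC {1}/pochn big_split_ord /= -/(pochn a k (c * N)) IH.
  rewrite -big_split /=; apply: eq_bigr => r _; rewrite pochnS.
  by do !congr (_ * _); congr (1 - q ^+ _); lia.
apply: eqmodq_prod => r; apply/eqmodq_sym/poch_pochn; first by rewrite muln_gt0 k_gt0.
by apply: leq_trans (leq_addl _ _); rewrite leq_pmull // muln_gt0 k_gt0.
Qed.

End Pochhammer.

(** * The q-binomial theorem *)

Section QBinomial.

Variable S : comNzRingType.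
Variable x : S.

(** Gaussian binomial coefficients through q-Pascal's rule, so that they make
    sense for any [x], including roots of unity; [qbin_fact] recovers the
    quotient of q-factorials. *)
Fixpoint qbin (n j : nat) : S :=
  match n, j with
  | _, 0 => 1
  | 0, _.+1 => 0
  | n'.+1, j'.+1 => qbin n' j'.+1 + x ^+ (n' - j') * qbin n' j'
  end.

Arguments qbin : simpl never.

Lemma qbinS n j : qbin n.+1 j.+1 = qbin n j.+1 + x ^+ (n - j) * qbin n j.
Proof. by []. Qed.

Lemma qbin0 n : qbin n 0 = 1.
Proof. by case: n. Qed.

Lemma qbin_small n j : (n < j)%N -> qbin n j = 0.
Proof.
elim: n j => [|n IH] [|j] //; rewrite ltnS => nj.
by rewrite qbinS !IH ?mulr0 ?addr0 // ltnS ltnW.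
Qed.

Definition qfact (n : nat) : S := \prod_(j < n) (1 - x ^+ j.+1).

Lemma qfactS n : qfact n.+1 = qfact n * (1 - x ^+ n.+1).
Proof. exact: big_ord_recr. Qed.

Lemma qbin_fact n j : (j <= n)%N -> qbin n j * (qfact j * qfact (n - j)) = qfact n.
Proof.
have fact0 : qfact 0 = 1 by rewrite /qfact big_ord0.
elim: n j => [|n IH] [|j]; rewrite ?qbin0 ?fact0 ?subn0 ?mul1r //.
rewrite ltnS subSS qbinS leq_eqVlt => /predU1P[->|jn].
  have := IH n (leqnn n).
  rewrite subnn fact0 (qbin_small (ltnSn n)) add0r expr0 mul1r !mulr1 => IHn.
  by rewrite !qfactS mulrA IHn.
have := IH _ jn; have := IH _ (ltnW jn).
rewrite -(subnSK jn) !qfactS => IH1 IH2.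
have -> : x ^+ n.+1 = x ^+ (n - j.+1).+1 * x ^+ j.+1.
  by rewrite -exprD subnSK // addnS subnK // ltnW.
set X := x ^+ (n - j.+1).+1; set Y := x ^+ j.+1.
transitivity (qfact n * (1 - X) + X * (qfact n * (1 - Y))); last by ring.
by rewrite -{1}IH2 -IH1 /X /Y; ring.
Qed.

Lemma qbinomial a b n :
  \prod_(i < n) (a + b * x ^+ i) =
  \sum_(j < n.+1) qbin n j * x ^+ 'C(j, 2) * b ^+ j * a ^+ (n - j).
Proof.
elim: n => [|n IH].
  by rewrite big_ord0 big_ord_recl big_ord0 qbin0 !expr0 !mulr1 addr0.
rewrite big_ord_recr /= {}IH mulrDr.
rewrite [RHS]big_ord_recl qbin0 subn0 bin0n !expr0 !mulr1 mul1r.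
under [in RHS]eq_bigr => j _ do rewrite lift0 qbinS subSS !mulrDl.
rewrite big_split /= addrA; congr (_ + _).
  transitivity (\sum_(j < n.+2) qbin n j * x ^+ 'C(j, 2) * b ^+ j * a ^+ (n.+1 - j)).
    rewrite [RHS]big_ord_recr /= (qbin_small (ltnSn n)) !mul0r addr0 mulr_suml.
    apply: eq_bigr => j _; have jn : (j <= n)%N by rewrite -ltnS.
    by rewrite (subSn jn) exprSr mulrA.
  by rewrite big_ord_recl qbin0 subn0 bin0n !expr0 !mulr1 mul1r.
rewrite mulr_suml; apply: eq_bigr => j _.
have jn : (j <= n)%N by rewrite -ltnS.
rewrite binS bin1 exprD exprS.
have -> : x ^+ n = x ^+ (n - j) * x ^+ j by rewrite -exprD subnK.
ring.
Qed.

End QBinomial.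

(** * Jacobi's triple product *)

(** The binomial coefficient of [n] and [2], for [n] of any sign. *)
Definition tri (n : int) : int := ((n * (n - 1)) %/ 2)%Z.

Lemma mul2tri (n : int) : 2 * tri n = n * (n - 1).
Proof.
have : (2 %| n * (n - 1))%Z.
  have [m [->|->]] : exists m : int, n = 2 * m \/ n = 2 * m + 1.
  - by exists (n %/ 2)%Z; lia.
  - by apply/dvdzP; exists (m * (2 * m - 1)); ring.
  - by apply/dvdzP; exists (m * (2 * m + 1)); ring.
by move=> /divzK dv; rewrite [LHS]mulrC.
Qed.

Lemma tri_nat (n : nat) : tri n%:Z = 'C(n, 2)%:Z.
Proof.
have := mul2tri n%:Z; have := bin2 n.
by case: n => [|n]; rewrite ?bin0n; lia.
Qed.

Section Terms.

Variable R : comUnitRingType.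
Local Notation q := (qvar R).

(** Signed monomials with integer data, meant for [0 <= e]: all the series below
    are sums of these, and an equality of terms reduces to a congruence modulo
    [2] and an equality of integers. *)
Definition qterm (s e : int) : fps R := (-1) ^+ `|s| * q ^+ `|e|.

Lemma eq_qterm (s s' e e' : int) :
  (s - s' = 0 %[mod 2])%Z -> e = e' -> qterm s e = qterm s' e'.
Proof.
move=> ss' <-; rewrite /qterm -signr_odd -[(-1) ^+ `|s'|]signr_odd.
by have -> : odd `|s| = odd `|s'| by lia.
Qed.

Lemma qtermM (s e s' e' : int) : 0 <= e -> 0 <= e' ->
  qterm s e * qterm s' e' = qterm (s + s') (e + e').
Proof.
move=> e_ge0 e'_ge0; rewrite /qterm mulrACA -!exprD.
have -> : (absz e + absz e')%N = absz (e + e') by lia.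
rewrite -[in LHS]signr_odd -[in RHS]signr_odd.
by have -> : odd (absz s + absz s') = odd (absz (s + s')) by lia.
Qed.

Lemma qtermN (s e : int) : - qterm s e = qterm (s + 1) e.
Proof.
rewrite /qterm -mulNr -[in LHS]signr_odd -[in RHS]signr_odd.
have -> : odd `|s + 1| = ~~ odd `|s| by lia.
by case: (odd _); rewrite ?opprK.
Qed.

Lemma eqmodq_qterm N (s e : int) : (N%:Z <= e) -> eqmodq N (qterm s e) 0.
Proof.
move=> Ne; rewrite -[0](mulr0 ((-1) ^+ `|s|)); apply: eqmodqM => //.
by apply: eqmodq_qvarX; lia.
Qed.

Definition zrange (n : nat) : seq int := [seq j%:Z - n%:Z | j <- iota 0 n.*2.+1].

Lemma zrange_uniq n : uniq (zrange n).
Proof. by rewrite map_inj_uniq ?iota_uniq // => i j; lia. Qed.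

Lemma mem_zrange n (t : int) : `|t| <= n%:Z -> t \in zrange n.
Proof.
move=> tn; apply/mapP; exists (absz (t + n%:Z)); first by rewrite mem_iota; lia.
by lia.
Qed.

(** An exponent growing at least like [`|t|] leaves finitely many terms below
    any power of [q]. *)
Lemma tail0_zrange (N n : nat) (s e : int -> int) :
  (forall t, `|t| <= e t) -> (N <= n)%N ->
  tail0 N (fun t => qterm (s t) (e t)) (zrange n).
Proof.
move=> te Nn t; case: (lerP `|t| n%:Z) => [/mem_zrange -> //|nt _].
by apply: eqmodq_qterm; have := te t; lia.
Qed.

Lemma summable_qterm (s e : int -> int) :
  (forall t, `|t| <= e t) -> summable (fun t => qterm (s t) (e t)).
Proof.
move=> te N; exists (zrange N); split; first exact: zrange_uniq.
exact: tail0_zrange.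
Qed.

(** With [x = q^k] and [z = q^a], the term [(-1)^t x^(t(t-1)/2) z^t] of Jacobi's
    triple product. *)
Definition theta (k a : nat) (t : int) : fps R :=
  qterm t (k%:Z * tri t + a%:Z * t).

Lemma theta_exp_ge (k a : int) (t : int) : 0 < a -> a < k ->
  `|t| <= k * tri t + a * t.
Proof.
move=> a_gt0 ak; have := mul2tri t.
have [->|[t_gt0|t_lt0]] : t = 0 \/ 1 <= t \/ t <= -1 by lia.
- move=> tri0; have -> : tri 0 = 0 by lia.
  by rewrite !mulr0.
- move=> tri2; have tri_ge0 : 0 <= tri t.
    have : 0 <= t * (t - 1) by apply: mulr_ge0; lia.
    by lia.
  have : 0 <= k * tri t by apply: mulr_ge0; lia.
  have : 0 <= (a - 1) * t by apply: mulr_ge0; lia.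
  by lia.
- move=> tri2; have tri_ge : - t <= tri t.
    have : 0 <= (- t) * (- (t + 1)) by apply: mulr_ge0; lia.
    by lia.
  have : 0 <= k * (tri t + t) by apply: mulr_ge0; lia.
  have : 0 <= (k - a - 1) * (- t) by apply: mulr_ge0; lia.
  by lia.
Qed.

(** The q-binomial theorem for the [2n] factors [x^n - z x^i], where [x = q^k] and
    [z = q^a].  For [i >= n] such a factor is [x^n (1 - z x^(i-n))], and for
    [i < n] it is [- z x^i (1 - x^(n-i) / z)]; the monomials thus pulled out,
    collected in [q^M], match the shift of the summation index by [n] in the
    exponents of the sum side. *)
Lemma finite_jacobi (k a n : nat) : (0 < a < k)%N ->
  pochn R (k - a) k n * pochn R a k n =
  \sum_(t <- zrange n) qbin (q ^+ k) n.*2 `|t + n%:Z| * theta k a t.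
Proof.
case/andP=> a_gt0 ak.
pose M := (a * n + k * 'C(n, 2) + k * n * n)%N.
have sgn2 m : (-1) ^+ m * (-1) ^+ m = 1 :> fps R.
  by rewrite -exprD addnn -signr_odd odd_double.
apply: (@qvarX_lreg R M); rewrite -[LHS]mul1r -[RHS]mul1r -(sgn2 n).
rewrite -!mulrA; congr (_ * _).
have := qbinomial (q ^+ k) (q ^+ (k * n)) (- q ^+ a) n.*2.
have -> : \prod_(i < n.*2) (q ^+ (k * n) + - q ^+ a * (q ^+ k) ^+ i) =
    (-1) ^+ n * (q ^+ M * (pochn R (k - a) k n * pochn R a k n)).
  rewrite -addnn big_split_ord /=.
  have -> : \prod_(i < n) (q ^+ (k * n) + - q ^+ a * (q ^+ k) ^+ i) =
      (-1) ^+ n * q ^+ (a * n + k * 'C(n, 2)) * pochn R (k - a) k n.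
    rewrite (eq_bigr (fun i : 'I_n => (-1) * q ^+ (a + k * i) *
                        (1 - q ^+ (k - a + k * (n - i.+1))))) /=; last first.
      move=> i _; rewrite -exprM [in LHS]mulNr -exprD.
      have -> : (k * n = (a + k * i) + (k - a + k * (n - i.+1)))%N.
        have := ltn_ord i; have := mulnBr k n i.+1.
        have : (k * i.+1 <= k * n)%N by rewrite leq_mul2l ltn_ord orbT.
        by rewrite mulnS; lia.
      by rewrite exprD; ring.
    rewrite big_split big_split /= prodr_const card_ord; congr (_ * _ * _).
      rewrite -expr_sum; congr (_ ^+ _).
      rewrite big_split /= sum_nat_const card_ord mulnC -big_distrr /=.
      by rewrite -bin2_sum big_mkord.
    rewrite /pochn [RHS](reindex_inj rev_ord_inj) /=.
    by apply: eq_bigr => i _.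
  have -> : \prod_(i < n) (q ^+ (k * n) + - q ^+ a * (q ^+ k) ^+ (n + i)) =
      q ^+ (k * n * n) * pochn R a k n.
    have -> : q ^+ (k * n * n) = \prod_(i < n) q ^+ (k * n).
      by rewrite prodr_const card_ord exprM.
    rewrite /pochn -big_split /=.
    apply: eq_bigr => i _; rewrite mulrBr mulr1 mulNr -!exprM -!exprD.
    by congr (_ - _ ^+ _); ring.
  by rewrite /M !exprD; ring.
move=> ->; rewrite !mulr_sumr big_map -[LHS](big_mkord xpredT (fun j =>
  qbin (q ^+ k) n.*2 j * (q ^+ k) ^+ 'C(j, 2) * (- q ^+ a) ^+ j *
     (q ^+ (k * n)) ^+ (n.*2 - j))) /index_iota subn0.
apply: eq_big_seq => j; rewrite mem_iota => /andP[_ jn].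
rewrite addrNK absz_nat /theta /qterm.
have -> : (-1) ^+ `|j%:Z - n%:Z| = (-1) ^+ n * (-1) ^+ j :> fps R.
  rewrite -exprD -[in LHS]signr_odd -[in RHS]signr_odd.
  by have -> : odd `|j%:Z - n%:Z| = odd (n + j) by lia.
set e := k%:Z * tri _ + _.
have e_ge0 : 0 <= e.
  have := theta_exp_ge (k := k%:Z) (a := a%:Z) (j%:Z - n%:Z).
  by rewrite -/e; lia.
have expE : (k * 'C(j, 2) + a * j + k * n * (n.*2 - j))%N = (M + absz e)%N.
  have triD : tri (j%:Z - n%:Z) = 'C(j, 2)%:Z - 'C(n, 2)%:Z - n%:Z * (j%:Z - n%:Z).
    have := mul2tri (j%:Z - n%:Z); rewrite -!tri_nat.
    have := mul2tri j%:Z; have := mul2tri n%:Z; lia.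
  have : (n.*2 - j)%N%:Z = 2 * n%:Z - j%:Z by lia.
  have : (absz e)%:Z = e by lia.
  move: e_ge0; rewrite /e /M triD; move: ('C(j, 2)) ('C(n, 2)) (absz _) => cj cn ae _.
  move: (n.*2 - j)%N => d aeE dE; apply/eqP; rewrite -eqz_nat !PoszD !PoszM dE aeE.
  by apply/eqP; ring.
have expqE : q ^+ (k * 'C(j, 2)) * q ^+ (a * j) * q ^+ (k * n * (n.*2 - j)) =
    q ^+ M * q ^+ `|e| by rewrite -!exprD expE.
rewrite -[- _]mulN1r exprMn -!exprM.
transitivity (qbin (q ^+ k) n.*2 j * (-1) ^+ j * (q ^+ M * q ^+ `|e|)).
  by rewrite -expqE; ring.
move: (sgn2 n) ((-1) ^+ j) (q ^+ M) (q ^+ `|e|) (qbin _ _ _) => + v w z b.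
move: ((-1) ^+ n) => u uu; transitivity (u * u * (b * v * (w * z))); last by ring.
by rewrite uu mul1r.
Qed.

(** In the finite identity multiplied by [(x; x)], the coefficient of [theta t] is
    [(x; x)] times the Gaussian binomial of [2n] and [n + t].  Modulo [q^N] it is
    [1] when [|t| <= N] and [n = 2N], since then the three q-factorials have at
    least [N] factors; for [|t| > N] the term itself vanishes. *)
Lemma jacobi_triple_product k a : (0 < a < k)%N ->
  is_sum (theta k a) (poch R k k * (poch R (k - a) k * poch R a k)).
Proof.
move=> /[dup] ak /andP[a_gt0 lt_ak] N.
have k_gt0 : (0 < k)%N by lia.
pose n := N.*2.
have theta_ge t : `|t| <= k%:Z * tri t + a%:Z * t by apply: theta_exp_ge; lia.
have kN m : (N <= m)%N -> (N <= k * m)%N.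
  by move=> Nm; apply: leq_trans Nm _; apply: leq_pmull.
exists (zrange n); split; first exact: zrange_uniq.
  by apply: tail0_zrange => //; rewrite /n; lia.
have prodE : eqmodq N (poch R k k * (poch R (k - a) k * poch R a k))
    (poch R k k * (pochn R (k - a) k n * pochn R a k n)).
  apply: eqmodqM => //; have := kN n; rewrite /n => kNn.
  by apply: eqmodqM; apply: poch_pochn => //; lia.
apply/eqmodq_sym/(eqmodq_trans prodE).
rewrite finite_jacobi // mulr_sumr; apply: eqmodq_sum => t.
rewrite mulrA; case: (lerP `|t| N%:Z) => tN; last first.
  have := theta_ge t; rewrite /theta; move: (_ + _) => e te.
  have theta0 : eqmodq N (qterm t e) 0 by apply: eqmodq_qterm; lia.
  apply: (eqmodq_trans (eqmodqM (eqmodq_refl _) theta0)).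
  by rewrite mulr0; apply: eqmodq_sym.
rewrite -[X in eqmodq _ _ X]mul1r; apply: eqmodqM => //.
have qfactE m : qfact (q ^+ k) m = pochn R k k m.
  by apply: eq_bigr => j _; rewrite -exprM mulnS.
have factE m : (N <= m)%N -> eqmodq N (qfact (q ^+ k) m) (poch R k k).
  move=> Nm; rewrite qfactE; apply/eqmodq_sym/poch_pochn => //.
  by apply: leq_trans (kN _ Nm) (leq_addl _ _).
have u : poch R k k \is a GRing.unit by apply: poch_unit.
pose m := absz (t + n%:Z).
have mn : (m <= n.*2)%N by rewrite /m /n; lia.
have := qbin_fact (q ^+ k) mn; rewrite -/m.
move: (qbin _ _ _) => b bE.
rewrite -[poch R k k * b](mulrK u) -(divrr u); apply: eqmodqM => //.
rewrite mulrAC mulrC; apply: eqmodq_trans (_ : eqmodq N _ (qfact (q ^+ k) n.*2)) _.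
  rewrite -bE; apply: eqmodqM => //.
  by apply: eqmodqM; apply/eqmodq_sym/factE; rewrite /m /n; lia.
by apply: factE; rewrite /n; lia.
Qed.

End Terms.

(** * The quintuple product identity *)

Lemma triD (x y : int) : tri (x + y) = tri x + tri y + x * y.
Proof. by have := mul2tri (x + y); have := mul2tri x; have := mul2tri y; lia. Qed.

Lemma triN (x : int) : tri (- x) = tri x + x.
Proof. by have := mul2tri (- x); have := mul2tri x; lia. Qed.

Lemma tri1 : tri 1 = 0.
Proof. by []. Qed.

Section Quintuple.

Variable R : comUnitRingType.
Local Notation q := (qvar R).

(** With [x = q^k] and [z = q^a], the sum side of the quintuple product identity is
    the sum over [t] of [(-1)^t x^(t(3t-1)/2) z^(3t) (1 + z x^t)]; [quint1] and
    [quint2] are the two halves of its term. *)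
Definition quint1 (k a : nat) (t : int) : fps R :=
  qterm R t (3 * k%:Z * tri t + (k%:Z + 3 * a%:Z) * t).

Definition quint2 (k a : nat) (t : int) : fps R :=
  qterm R t (3 * k%:Z * tri t + (2 * k%:Z + 3 * a%:Z) * t + a%:Z).

Lemma quint1_exp_ge (k a : nat) (t : int) : (a.*2 < k)%N ->
  `|t| <= 3 * k%:Z * tri t + (k%:Z + 3 * a%:Z) * t.
Proof. by move=> ak; apply: theta_exp_ge; lia. Qed.

Lemma quint2_exp_ge (k a : nat) (t : int) : (a.*2 < k)%N ->
  `|t| <= 3 * k%:Z * tri t + (2 * k%:Z + 3 * a%:Z) * t + a%:Z.
Proof.
move=> ak; have := mul2tri t.
have [t_ge0|t_lt0] : 0 <= t \/ t <= -1 by lia.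
  have : 0 <= t * (t - 1).
    have [->|t_gt0] : t = 0 \/ 1 <= t by lia.
      by [].
    by apply: mulr_ge0; lia.
  move=> tt tri2; have : 0 <= 3 * k%:Z * tri t by apply: mulr_ge0; lia.
  have : 0 <= (2 * k%:Z + 3 * a%:Z - 1) * t by apply: mulr_ge0; lia.
  by lia.
move=> tri2; have : 0 <= k%:Z * ((- 3 * t - 1) * (- t - 1)).
  by do 2?apply: mulr_ge0; lia.
have : 0 <= (k%:Z - 1 - 2 * a%:Z) * (- 3 * t - 1) by apply: mulr_ge0; lia.
have : 2 * (k%:Z * tri t) = k%:Z * (t * (t - 1)) by rewrite -tri2; ring.
by lia.
Qed.

(** Pairs of integers sorted by the parity of their sum.  The maps used below have
    half-integral matrices and become unimodular in these coordinates. *)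
Definition parity_split (x : bool * (int * int)) : int * int :=
  (x.2.1 + x.2.2, x.2.1 - x.2.2 + x.1%:R).

Definition parity_join (x : int * int) : bool * (int * int) :=
  let b := odd (absz (x.1 + x.2)) in
  (b, (((x.1 + x.2 - b%:R) %/ 2)%Z, ((x.1 - x.2 + b%:R) %/ 2)%Z)).

Lemma parity_splitK : cancel parity_split parity_join.
Proof.
move=> [b [x y]]; rewrite /parity_join /parity_split /=.
have -> : odd (absz (x + y + (x - y + b%:R))) = b by case: b; lia.
by case: b; congr (_, (_, _)); lia.
Qed.

Lemma parity_joinK : cancel parity_join parity_split.
Proof.
move=> [m n]; rewrite /parity_join /parity_split /=.
case: (boolP (odd _)) => mn /=; congr (_, _); lia.
Qed.

(** Completing squares, the exponents on the left are [k / 2] times [3 X^2 + Y^2],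
    up to a common constant, with [X = m - 1/6] and [Y = n - 1/2 + 2 a / k]; on the
    right [X] is [m - 1/6 + a / k] or [m + 1/6 + a / k], and [Y = n - 1/2 + a / k].
    The isometries [(X, Y) -> ((Y - X) / 2, (Y + 3 X) / 2)] and
    [(X, Y) -> ((X + Y) / 2, (Y - 3 X) / 2)] carry the pairs of even sum on the
    left to those of the first family, and the pairs of odd sum to those of the
    second one.  What remains on the right, the odd pairs of the first family
    and the even pairs of the second one, is matched with opposite signs by
    [(X, Y) -> ((X + Y) / 2, (3 X - Y) / 2)]. *)
Lemma quintuple_product k a (f g h u v : fps R) : (0 < a)%N -> (a.*2 < k)%N ->
  is_sum (theta R (3 * k) k) f -> is_sum (theta R k a.*2) g ->
  is_sum (theta R k a) h -> is_sum (quint1 k a) u -> is_sum (quint2 k a) v ->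
  f * g = h * (u + v).
Proof.
move=> a_gt0 ak fP gP hP uP vP.
have e0 t : 0 <= (3 * k)%N%:Z * tri t + k%:Z * t.
  by have := @theta_exp_ge (3 * k)%N%:Z k%:Z t; lia.
have e1 t : 0 <= k%:Z * tri t + a.*2%:Z * t.
  by have := @theta_exp_ge k%:Z a.*2%:Z t; lia.
have e2 t : 0 <= k%:Z * tri t + a%:Z * t.
  by have := @theta_exp_ge k%:Z a%:Z t; lia.
have e3 t := le_trans (normr_ge0 t) (quint1_exp_ge t ak).
have e4 t := le_trans (normr_ge0 t) (quint2_exp_ge t ak).
have a2 : a.*2%:Z = 2 * a%:Z by lia.
have [L -> LP] := is_sum_split parity_splitK parity_joinK (is_sumM fP gP).
have [A AE AP] := is_sum_split parity_splitK parity_joinK (is_sumM uP hP).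
have [B BE BP] := is_sum_split parity_splitK parity_joinK (is_sumM vP hP).
have k3 : (3 * k)%N%:Z = 3 * k%:Z by lia.
have ktri t : k%:Z * (2 * tri t) = k%:Z * (t * (t - 1)) by rewrite mul2tri.
rewrite mulrDr ![h * _]mulrC {}AE {}BE !big_bool /=.
(* even pairs: (m, n) goes to ((n - m) / 2, (n + 3 m) / 2) *)
have LA : L false = A false.
  apply: (is_sum_unique (LP false)).
  have phiK : involutive (fun x : int * int => (x.1, - x.1 - x.2)).
    by move=> [x y] /=; congr (_, _); ring.
  apply: eq_is_sum (is_sum_reindex phiK phiK (AP false)) => -[x y] /=.
  rewrite /theta /quint1 !qtermM // !(addr0, addrA) !(triD, triN) a2 k3.
  by have kx := ktri x; have ky := ktri y; apply: eq_qterm; lia.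
(* odd pairs: (m, n) goes to ((m + n - 1) / 2, (n - 3 m + 1) / 2) *)
have LB : L true = B true.
  apply: (is_sum_unique (LP true)).
  pose phi (x : int * int) := (- x.2, x.1 + x.2).
  have phiK : cancel phi (fun x : int * int => (x.2 + x.1, - x.1)).
    by move=> [x y]; rewrite /phi /=; congr (_, _); ring.
  have phiK' : cancel (fun x : int * int => (x.2 + x.1, - x.1)) phi.
    by move=> [x y]; rewrite /phi /=; congr (_, _); ring.
  apply: eq_is_sum (is_sum_reindex phiK phiK' (BP true)) => -[x y] /=.
  rewrite /theta /quint2 !qtermM // !addrA !(triD, triN, tri1) a2 k3.
  by have kx := ktri x; have ky := ktri y; apply: eq_qterm; lia.
(* cancellation: (m, n) goes to ((m + n - 1) / 2, (3 m - n + 1) / 2) *)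
have AB : A true = - B false.
  apply: (is_sum_unique (AP true)); rewrite -mulN1r.
  have phiK : involutive (fun x : int * int => (x.1 + x.2, - x.2)).
    by move=> [x y] /=; congr (_, _); ring.
  apply: eq_is_sum (is_sum_reindex phiK phiK (is_sumZ (-1) (BP false))) => -[x y] /=.
  rewrite /theta /quint1 /quint2 !qtermM // mulN1r qtermN !(addr0, addrA).
  rewrite !(triD, triN, tri1).
  by have kx := ktri x; have ky := ktri y; apply: eq_qterm; lia.
by rewrite LA LB AB; ring.
Qed.

End Quintuple.

(** * The 5-dissection of Euler's product *)

Section Pentagonal.

Variable R : comUnitRingType.
Local Notation q := (qvar R).

(** The pentagonal number theorem is the triple product for [x = q^(3k)] and
    [z = q^k], whose three products interleave to [(q^k; q^k)]. *)
Lemma is_sum_euler k : (0 < k)%N -> is_sum (theta R (3 * k) k) (poch R k k).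
Proof.
move=> k_gt0; have jtp : (0 < k < 3 * k)%N by lia.
have := jacobi_triple_product R jtp.
rewrite (poch_multisection R k k_gt0 (isT : 0 < 3)%N) !big_ord_recl big_ord0.
have -> : (k + k * (@ord0 2) = k)%N by rewrite muln0 addn0.
have -> : (k + k * lift (@ord0 2) (@ord0 1) = 3 * k - k)%N by rewrite lift0 /=; lia.
have -> : (k + k * lift (@ord0 2) (lift (@ord0 1) (@ord0 0)) = 3 * k)%N.
  by rewrite !lift0 /=; lia.
rewrite [(k * 3)%N]mulnC; set x := poch _ _ _; set y := poch _ _ _; set z := poch _ _ _.
by rewrite (_ : x * (y * z) = z * (y * (x * 1))) //; ring.
Qed.

Definition split5 (x : 'I_5 * int) : int := 5 * x.2 + (x.1 : nat)%:Z.

Definition join5 (t : int) : 'I_5 * int :=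
  (inord (absz (t %% 5)%Z), (t %/ 5)%Z).

Lemma split5K : cancel split5 join5.
Proof.
move=> [r j]; rewrite /split5 /join5 /=; have r5 := ltn_ord r.
congr (_, _); last lia.
by apply: val_inj; rewrite /= inordK; lia.
Qed.

Lemma join5K : cancel join5 split5.
Proof. by move=> t; rewrite /split5 /join5 /= inordK; lia. Qed.

(** With [n = 5 j + r], the pentagonal exponent [n (3 n - 1) / 2] is [0], [1], [2],
    [2], [2] or [0] modulo [5]: the classes [r = 0, 2] give the residue [0] and
    the classes [r = 3, 4] the residue [2].  The index has to be reversed for
    [r = 0, 1, 4] to reach the standard form of the target series. *)
Lemma euler_5dissection u1 v1 u2 v2 :
  is_sum (quint1 R 25 5) u1 -> is_sum (quint2 R 25 5) v1 ->
  is_sum (quint1 R 25 10) u2 -> is_sum (quint2 R 25 10) v2 ->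
  poch R 1 1 = (u1 + v1) - q * poch R 25 25 - q ^+ 2 * (u2 + v2).
Proof.
move=> u1P v1P u2P v2P.
have [l -> lP] := is_sum_split split5K join5K (is_sum_euler (isT : 0 < 1)%N).
have eP := is_sum_euler (isT : 0 < 25)%N.
have qE : q = qterm R 0 1 by rewrite /qterm mul1r.
have q2E : q ^+ 2 = qterm R 0 2 by rewrite /qterm mul1r.
have oppK : involutive (fun x : int => - x) by exact: opprK.
have opp1K : involutive (fun x : int => - x - 1) by move=> x; ring.
have thE (r : nat) (i : 'I_5) (j : int) : val i = r ->
    exists e, theta R (3 * 1) 1 (split5 (i, j)) = qterm R (j + r%:Z) e /\
      2 * e = (5 * j + r%:Z) * (15 * j + 3 * r%:Z - 1).
  move=> ir; rewrite /theta /split5 /= [nat_of_ord i]ir; set t := 5 * j + _.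
  exists (3 * tri t + t); split; first by apply: eq_qterm; rewrite /t; lia.
  by have := mul2tri t; rewrite {2 3}/t => tri_t; rewrite /t in tri_t *; lia.
rewrite !big_ord_recl big_ord0.
have -> : l ord0 = u1.
  apply: (is_sum_unique (lP _)).
  apply: eq_is_sum (is_sum_reindex oppK oppK u1P) => j /=.
  have [e [-> eE]] := thE 0 ord0 j erefl.
  by apply: eq_qterm; have := mul2tri (- j); lia.
have -> : l (lift ord0 ord0) = - q * poch R 25 25.
  apply: (is_sum_unique (lP _)).
  apply: eq_is_sum (is_sum_reindex oppK oppK (is_sumZ (- q) eP)) => j /=.
  have [e [-> eE]] := thE 1 (lift ord0 ord0) j erefl.
  have := @theta_exp_ge (3 * 25)%N 25%N (- j) isT isT.
  rewrite /theta mulNr {1}qE => e0; rewrite qtermM ?qtermN //; last lia.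
  by apply: eq_qterm; have := mul2tri (- j); lia.
have -> : l (lift ord0 (lift ord0 ord0)) = v1.
  apply: (is_sum_unique (lP _)).
  apply: eq_is_sum v1P => j.
  have [e [-> eE]] := thE 2 (lift ord0 (lift ord0 ord0)) j erefl.
  by apply: eq_qterm; have := mul2tri j; lia.
have -> : l (lift ord0 (lift ord0 (lift ord0 ord0))) = - q ^+ 2 * v2.
  apply: (is_sum_unique (lP _)).
  apply: eq_is_sum (is_sumZ (- q ^+ 2) v2P) => j.
  have [e [-> eE]] := thE 3 (lift ord0 (lift ord0 (lift ord0 ord0))) j erefl.
  have e0 := @quint2_exp_ge 25 10 j isT.
  rewrite /quint2 mulNr q2E qtermM ?qtermN //; last lia.
  by apply: eq_qterm; have := mul2tri j; lia.
have -> : l (lift ord0 (lift ord0 (lift ord0 (lift ord0 ord0)))) = - q ^+ 2 * u2.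
  apply: (is_sum_unique (lP _)).
  apply: eq_is_sum (is_sum_reindex opp1K opp1K (is_sumZ (- q ^+ 2) u2P)) => j /=.
  have [e [-> eE]] :=
    thE 4 (lift ord0 (lift ord0 (lift ord0 (lift ord0 ord0)))) j erefl.
  have e0 := @quint1_exp_ge 25 10 (- j - 1) isT.
  rewrite /quint1 mulNr q2E qtermM ?qtermN //; last lia.
  by apply: eq_qterm; have := mul2tri (- j - 1); lia.
by ring.
Qed.

End Pentagonal.

Section Dissection.

Variable R : comUnitRingType.
Local Notation q := (qvar R).
Local Notation P1 := (poch R 5 25).
Local Notation P2 := (poch R 10 25).
Local Notation P3 := (poch R 15 25).
Local Notation P4 := (poch R 20 25).
Local Notation P5 := (poch R 25 25).

(** The quintuple identities for [a = 5] and [a = 10] express the components of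
    residue [0] and [2] as [P2 P3 P5 / (P1 P4)] and [P1 P4 P5 / (P2 P3)]; the rest
    is a computation with units. *)
Lemma euler_dissection_products :
  poch R 1 1 / poch R 5 5 ^+ 2 =
    (P1 ^+ 3 * (P2 * P3 * P4 ^+ 3 * P5))^-1
    - q * (P1 ^+ 2 * (P2 ^+ 2 * P3 ^+ 2 * P4 ^+ 2 * P5))^-1
    - q ^+ 2 * (P1 * (P2 ^+ 3 * P3 ^+ 3 * P4 * P5))^-1.
Proof.
have E5 : poch R 5 5 = P1 * P2 * P3 * P4 * P5.
  rewrite (poch_multisection R 5 (isT : 0 < 5)%N (isT : 0 < 5)%N).
  rewrite -(big_mkord xpredT (fun r => poch R (5 + 5 * r) (5 * 5))).
  by rewrite !big_nat_recr //= big_geq // mul1r.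
have [u1 u1P] := summable_is_sum (@summable_qterm R id _
  (fun t => @quint1_exp_ge 25 5 t isT)).
have [v1 v1P] := summable_is_sum (@summable_qterm R id _
  (fun t => @quint2_exp_ge 25 5 t isT)).
have [u2 u2P] := summable_is_sum (@summable_qterm R id _
  (fun t => @quint1_exp_ge 25 10 t isT)).
have [v2 v2P] := summable_is_sum (@summable_qterm R id _
  (fun t => @quint2_exp_ge 25 10 t isT)).
have jtp a : (0 < a < 25)%N -> is_sum (theta R 25 a) _ := @jacobi_triple_product R 25 a.
have eP := @is_sum_euler R 25 isT.
have Q1 : P5 * (P5 * (P3 * P2)) = P5 * (P4 * P1) * (u1 + v1).
  exact: (@quintuple_product R 25 5 _ _ _ _ _ isT isT eP (jtp 10 isT) (jtp 5 isT)).
have Q2 : P5 * (P5 * (P1 * P4)) = P5 * (P3 * P2) * (u2 + v2).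
  exact: (@quintuple_product R 25 10 _ _ _ _ _ isT isT eP (jtp 20 isT) (jtp 10 isT)).
rewrite (euler_5dissection u1P v1P u2P v2P) E5.
have := poch_unit R (isT : 0 < 5)%N (isT : 0 < 25)%N.
have := poch_unit R (isT : 0 < 10)%N (isT : 0 < 25)%N.
have := poch_unit R (isT : 0 < 15)%N (isT : 0 < 25)%N.
have := poch_unit R (isT : 0 < 20)%N (isT : 0 < 25)%N.
have := poch_unit R (isT : 0 < 25)%N (isT : 0 < 25)%N.
move: P1 P2 P3 P4 P5 (u1 + v1) (u2 + v2) Q1 Q2 => a b c d e x y Q1 Q2.
move=> /divrr + /divrr + /divrr + /divrr + /divrr.
(* the inverses become variables, so that both sides are polynomials *)
move: a^-1 b^-1 c^-1 d^-1 e^-1 => a' b' c' d' e' ee' dd' cc' bb' aa'.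
have xE : x = e * b * c * a' * d'.
  transitivity ((e * e') * (d * d') * (a * a') * x).
    by rewrite aa' dd' ee' !mul1r.
  transitivity (e' * d' * a' * (e * (d * a) * x)); first by ring.
  rewrite -Q1; transitivity ((e * e') * (e * b * c * a' * d')); first by ring.
  by rewrite ee' mul1r.
have yE : y = e * a * d * b' * c'.
  transitivity ((e * e') * (b * b') * (c * c') * y).
    by rewrite bb' cc' ee' !mul1r.
  transitivity (e' * b' * c' * (e * (c * b) * y)); first by ring.
  rewrite -Q2; transitivity ((e * e') * (e * a * d * b' * c')); first by ring.
  by rewrite ee' mul1r.
have -> : ((a * b * c * d * e) ^+ 2)^-1 = (a' * b' * c' * d' * e') ^+ 2.
  apply: mulr1_eq; transitivity ((a * a' * (b * b') * (c * c') * (d * d') * (e * e')) ^+ 2).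
    by ring.
  by rewrite aa' bb' cc' dd' ee' !mul1r expr1n.
have -> : (a ^+ 3 * (b * c * d ^+ 3 * e))^-1 = a' ^+ 3 * (b' * c' * d' ^+ 3 * e').
  apply: mulr1_eq.
  transitivity ((a * a') ^+ 3 * (b * b') * (c * c') * (d * d') ^+ 3 * (e * e')).
    by ring.
  by rewrite aa' bb' cc' dd' ee' !mulr1 !expr1n mulr1.
have -> : (a ^+ 2 * (b ^+ 2 * c ^+ 2 * d ^+ 2 * e))^-1 =
    a' ^+ 2 * (b' ^+ 2 * c' ^+ 2 * d' ^+ 2 * e').
  apply: mulr1_eq.
  transitivity ((a * a' * (b * b') * (c * c') * (d * d')) ^+ 2 * (e * e')).
    by ring.
  by rewrite aa' bb' cc' dd' ee' !mulr1 !expr1n.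
have -> : (a * (b ^+ 3 * c ^+ 3 * d * e))^-1 = a' * (b' ^+ 3 * c' ^+ 3 * d' * e').
  apply: mulr1_eq.
  transitivity ((a * a') * ((b * b') * (c * c')) ^+ 3 * (d * d') * (e * e')).
    by ring.
  by rewrite aa' bb' cc' dd' ee' !mulr1 !expr1n mulr1.
rewrite xE yE.
transitivity ((b * b') * (c * c') * (e * e') * (a' ^+ 3 * (b' * c' * d' ^+ 3 * e'))
  - (e * e') * (q * (a' ^+ 2 * (b' ^+ 2 * c' ^+ 2 * d' ^+ 2 * e')))
  - (a * a') * (d * d') * (e * e') * (q ^+ 2 * (a' * (b' ^+ 3 * c' ^+ 3 * d' * e')))).
  by ring.
by rewrite aa' bb' cc' dd' ee' !mul1r.
Qed.

End Dissection.

(** * Signs of the coefficients of reciprocal products *)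

Section Positivity.

Variable d : nat.
Implicit Types f g : fps int.

Definition fnonneg f := forall n, 0 <= f n /\ (~~ (d %| n)%N -> f n = 0).

Definition fpositive f := forall n, Num.sg (f n) = (d %| n)%N%:R.

Lemma fpositive_nonneg f : fpositive f -> fnonneg f.
Proof.
move=> fP n; split; first by rewrite -sgr_ge0 fP; case: (_ %| _)%N.
by move=> /negbTE dn; apply/eqP; rewrite -sgr_eq0 fP dn.
Qed.

Lemma fnonnegM f g : fnonneg f -> fnonneg g -> fnonneg (f * g).
Proof.
move=> fP gP n; rewrite fcoefM; split.
  by apply: sumr_ge0 => i _; apply: mulr_ge0; [case: (fP i) | case: (gP (n - i)%N)].
move=> dn; apply: big1 => i _; have [fi fi0] := fP i; have [gi gi0] := gP (n - i)%N.
have [di|/fi0 ->] := boolP (d %| i)%N; last by rewrite mul0r.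
rewrite gi0 ?mulr0 //; apply: contra dn => dni.
by rewrite -(subnK (_ : i <= n)%N) ?dvdn_add // -ltnS.
Qed.

(** In the coefficient at a multiple [n] of [d], the summand [f n * g 0] is already
    positive. *)
Lemma fpositiveM f g : fpositive f -> fnonneg g -> 0 < g 0%N -> fpositive (f * g).
Proof.
move=> fP gP g0 n; have fP' := fpositive_nonneg fP.
have [dn|dn] := boolP (d %| n)%N; last first.
  by have [_ ->] := fnonnegM fP' gP n; rewrite ?sgr0.
apply: gtr0_sg; rewrite fcoefM big_ord_recr /= subnn; apply: ltr_wpDl.
  by apply: sumr_ge0 => i _; apply: mulr_ge0; [case: (fP' i) | case: (gP (n - i)%N)].
by apply: mulr_gt0 => //; rewrite -sgr_gt0 fP dn.
Qed.

Lemma fnonneg1 : fnonneg 1.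
Proof.
move=> n; rewrite fcoef1; split; first by case: eqP.
by case: eqP => // ->; rewrite dvdn0.
Qed.

Lemma fcoef0V f : f \is a GRing.unit -> f^-1 0%N = (f 0%N)^-1.
Proof.
move=> uf; apply: esym; apply: mulr1_eq.
by rewrite -fcoef0M divrr.
Qed.

Lemma geometric_series a n : (0 < a)%N ->
  (1 - qvar int ^+ a)^-1 n = (a %| n)%N%:R.
Proof.
move=> a_gt0; pose g : fps int := Fps (fun n => (a %| n)%N%:R).
suff -> : (1 - qvar int ^+ a)^-1 = g by [].
have gE : (1 - qvar int ^+ a) * g = 1.
  apply: fpsP => m; rewrite mulrBl mul1r fcoefB coef_qvarXM fcoef1.
  rewrite /g /fcoef /=; case: leqP => [am|ma]; last first.
    case: m ma => [|m] ma; first by rewrite dvdn0 subr0.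
    by rewrite gtnNdvd // subr0.
  rewrite -{1}(subnK am) dvdn_addl // subrr.
  by rewrite (_ : (m == 0%N) = false) //; lia.
exact: mulr1_eq gE.
Qed.

Lemma fnonneg_poch a k : (0 < a)%N -> (0 < k)%N -> (d %| a)%N -> (d %| k)%N ->
  fnonneg (poch int a k)^-1.
Proof.
move=> a_gt0 k_gt0 da dk n.
have pu m : pochn int a k m \is a GRing.unit by apply/unit_fps/pochn_coef0.
have -> : (poch int a k)^-1 n = (pochn int a k n.+1)^-1 n.
  apply: (@eqmodqV _ n.+1) => //; first exact: poch_unit.
  by apply: poch_pochn => //; rewrite (leq_trans (leq_pmull n.+1 k_gt0)) ?leq_addl.
suff nn m : fnonneg (pochn int a k m)^-1 by exact: nn.
elim: m => [|m IH]; first by rewrite /pochn big_ord0 invr1; apply: fnonneg1.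
have u : 1 - qvar int ^+ (a + k * m) \is a GRing.unit.
  by have := pu m.+1; rewrite pochnS unitrM => /andP[].
rewrite pochnS invrM //; apply: fnonnegM => // i.
rewrite geometric_series ?addn_gt0 ?a_gt0 //; split; first by case: (_ %| _)%N.
move=> di; case: (boolP (_ %| i)%N) => // akm; case/negP: di.
by apply: dvdn_trans akm; rewrite dvdn_add // dvdn_mulr.
Qed.

(** The first factor of the product supplies [1 / (1 - q^d)], which is positive at
    all multiples of [d]. *)
Lemma fpositive_poch k : (0 < d)%N -> (0 < k)%N -> (d %| k)%N ->
  fpositive (poch int d k)^-1.
Proof.
move=> d_gt0 k_gt0 dk; rewrite poch_shift // invrM; last 2 first.
- by apply: unit_fps; rewrite fcoefB fcoef1 qvarXE /=; lia.
- by apply: poch_unit; lia.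
rewrite mulrC; apply: fpositiveM.
- move=> n; rewrite geometric_series //.
  by case: (_ %| _)%N; rewrite ?sgr0 ?sgr1.
- by apply: fnonneg_poch; rewrite ?dvdn_addl //; lia.
- by rewrite fcoef0V ?poch_unit ?poch_coef0 //; lia.
Qed.

End Positivity.

(** * The signs of the quotient *)

Theorem theorem1p1 (n : nat) :
  s_1p1_5m2 n = match (n %% 5)%N with
                | 0 => 1
                | 1 | 2 => -1
                | _ => 0
                end.
Proof.
pose good (f : fps int) := f 0%N = 1 /\ fnonneg 5 f^-1.
have good_unit f : good f -> f \is a GRing.unit by case=> /unit_fps.
have goodM f g : good f -> good g -> good (f * g).
  move=> fP gP; have [f0 fV] := fP; have [g0 gV] := gP.
  split; first by rewrite fcoef0M f0 g0.
  by rewrite invrM ?good_unit //; apply: fnonnegM.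
have goodX f m : good f -> good (f ^+ m).
  move=> fP; elim: m => [|m IH]; last by rewrite exprS; apply: goodM.
  by split; rewrite ?invr1 //; apply: fnonneg1.
have good_poch k : (0 < k)%N -> (5 %| k)%N -> good (poch int k 25).
  move=> k_gt0 k5; split; first exact: poch_coef0.
  exact: fnonneg_poch.
have positiveV g : good g -> fpositive 5 (poch int 5 25 * g)^-1.
  move=> gP; have [g0 gV] := gP; rewrite invrM ?good_unit //; last exact: good_poch.
  rewrite mulrC; apply: fpositiveM => //; first exact: fpositive_poch.
  by rewrite fcoef0V ?good_unit // g0.
have g1 := good_poch 5 isT isT; have g2 := good_poch 10 isT isT.
have g3 := good_poch 15 isT isT; have g4 := good_poch 20 isT isT.
have g5 := good_poch 25 isT isT.
rewrite /s_1p1_5m2 /C_1p1_5m2 -[qpoch_inf (qvar int) _]/(poch int 1 1).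
rewrite -[qpoch_inf (qvar int ^+ 5) _]/(poch int 5 5) euler_dissection_products.
move: (poch int 5 25) (poch int 10 25) (poch int 15 25) (poch int 20 25)
  (poch int 25 25) positiveV g1 g2 g3 g4 g5 => a b c d e positiveV ga gb gc gd ge.
have A0P : fpositive 5 (a ^+ 3 * (b * c * d ^+ 3 * e))^-1.
  by rewrite exprS -mulrA; apply: (positiveV); do ?[assumption | apply: (goodM) | apply: (goodX)].
have A1P : fpositive 5 (a ^+ 2 * (b ^+ 2 * c ^+ 2 * d ^+ 2 * e))^-1.
  by rewrite expr2 -mulrA; apply: (positiveV); do ?[assumption | apply: (goodM) | apply: (goodX)].
have A2P : fpositive 5 (a * (b ^+ 3 * c ^+ 3 * d * e))^-1.
  by apply: (positiveV); do ?[assumption | apply: (goodM) | apply: (goodX)].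
move: {positiveV ga gb gc gd ge} A0P A1P A2P.
move: (a ^+ 3 * _)^-1 (a ^+ 2 * _)^-1 (a * _)^-1 => A0 A1 A2 A0P A1P A2P.
have sgE f m : fpositive 5 f -> (m < 5)%N ->
    Num.sg ((qvar int ^+ m * f) n) = (n %% 5 == m)%N%:R.
  move=> fP m5; rewrite coef_qvarXM; case: leqP => mn; last first.
    by rewrite sgr0 modn_small ?ltn_eqF //; lia.
  by rewrite fP; congr (nat_of_bool _)%:R; lia.
have := sgE _ 0 A0P isT; have := sgE _ 1 A1P isT; have := sgE _ 2 A2P isT.
rewrite !fcoefB expr0 mul1r expr1.
move: (A0 n) ((_ * A1) n) ((_ * A2) n) => x y z.
have sg0 (t : int) : Num.sg t = 0 -> t = 0 by move=> /eqP; rewrite sgr_eq0 => /eqP.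
case: (n %% 5)%N => [|[|[|r]]] /=.
- by move=> /sg0 -> /sg0 -> xE; rewrite !subr0.
- by move=> /sg0 -> yE /sg0 ->; rewrite sub0r subr0 sgrN yE.
- by move=> zE /sg0 -> /sg0 ->; rewrite subrr sub0r sgrN zE.
- by move=> /sg0 -> /sg0 -> /sg0 ->; rewrite !subr0 sgr0.
Qed.
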